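(* Let $X$ be a normed space and let $\varphi_1,\varphi_2:X\to(-\infty,\infty]$ be calm at $\bar x$. The following assertions hold. (i) $\widehat\partial(\varphi_1\cdot\varphi_2)(\bar x)=\widehat\partial\big(\varphi_2(\bar x)\varphi_1+\varphi_1(\bar x)\varphi_2\big)(\bar x)$ and $\widehat\partial^{\infty}(\varphi_1\cdot\varphi_2)(\bar x)=\{0\}$. If in addition $\varphi_1$ is Fréchet differentiable at $\bar x$, then $$\widehat\partial(\varphi_1\cdot\varphi_2)(\bar x)=\nabla\varphi_1(\bar x)\varphi_2(\bar x)+\widehat\partial\big(\varphi_1(\bar x)\varphi_2\big)(\bar x).$$ (ii) Assume that $\varphi_2(\bar x)\neq0$. Then $$\widehat\partial(\varphi_1/\varphi_2)(\bar x)=\frac{\widehat\partial\big(\varphi_2(\bar x)\varphi_1-\varphi_1(\bar x)\varphi_2\big)(\bar x)}{[\varphi_2(\bar x)]^2},\qquad\widehat\partial^{\infty}(\varphi_1/\varphi_2)(\bar x)=\{0\}.$$ If in addition $\varphi_1$ is Fréchet differentiable at $\bar x$, then $$\widehat\partial(\varphi_1/\varphi_2)(\bar x)=\frac{\nabla\varphi_1(\bar x)\varphi_2(\bar x)+\widehat\partial\big(-\varphi_1(\bar x)\varphi_2\big)(\bar x)}{[\varphi_2(\bar x)]^2}.$$ (iii) Let $\varphi:X\to(-\infty,\infty]$ be calm at $\bar x$ with $\varphi(\bar x)\neq0$. Then $$\widehat\partial(1/\varphi)(\bar x)=-\frac{\widehat\partial^{+}\varphi(\bar x)}{[\varphi(\bar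 x)]^2},\qquad\widehat\partial^{\infty}(1/\varphi)(\bar x)=\{0\}.$$
   Context: $X^*$ is the topological dual of $X$; $\mathbb B(\bar x,r)$ is the open ball; $X\times\mathbb R$ carries the sum norm; $\operatorname{epi}f=\{(x,\alpha)\in X\times\mathbb R\mid\alpha\ge f(x)\}$. Calmness: $f:X\to(-\infty,\infty]$ is calm at $\bar x$ if there are $r>0$, $\ell\ge0$ with $|f(x)-f(\bar x)|\le\ell\|x-\bar x\|$ for all $x\in\mathbb B(\bar x,r)$; in particular $f$ is finite on that ball. Products and quotients are therefore well defined near $\bar x$ (denominators being nonzero near $\bar x$), and the subdifferentials below depend only on the values of the functions near $\bar x$. Regular subdifferential: for $f$ finite at $\bar x$, $\widehat\partial f(\bar x)$ is the set of $x^*\in X^*$ such that for every $\varepsilon>0$ there is $\gamma>0$ with $f(x)-f(\bar x)-\langle x^*,x-\bar x\rangle\ge-\varepsilon\|x-\bar x\|$ for all $x\in\mathbb B(\bar x,\gamma)$. Upper regular subdifferential: $\widehat\partial^{+}f(\bar x):=-\widehat\partial(-f)(\bar x)$. Regular normal cone: for $S\subset Z$ and $\bar z\in S$, $\widehat N(\bar z;S)=\{z^*\in Z^*\mid \limsup_{z\to\bar z,\,z\in S}\langle z^*,\frac{z-\bar z}{\|z-\bar z\|}\rangle\le0\}$. Singular regular subdifferential: $\widehat\partial^{\infty}f(\bar x)=\{x^*\in X^*\mid(x^*,0)\in\widehat N((\bar x,f(\bar x));\operatorname{epi}f)\}$. *)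

(* Defs.v *)
From HB Require Import structures.
From mathcomp Require Import all_boot all_order all_algebra.
From mathcomp Require Import all_classical all_reals all_analysis.

Set Implicit Arguments.
Unset Strict Implicit.
Unset Printing Implicit Defensive.

Import Order.TTheory GRing.Theory Num.Theory.
Import numFieldNormedType.Exports.

Local Open Scope classical_set_scope.
Local Open Scope ring_scope.

(* The canonical norm on [X * Y] is the max norm; [sum_prod X Y] is an alias of
   [X * Y] normed by the sum of the norms. *)
Definition sum_prod (R : realType) (X Y : normedModType R) : Type :=
  (X * Y)%type.

Section SumProd.
Variables (R : realType) (X Y : normedModType R).

HB.instance Definition _ := GRing.Lmodule.copy (sum_prod X Y) (X * Y)%type.

Definition sum_norm (z : sum_prod X Y) : R := `|z.1| + `|z.2|.

Lemma ler_sum_normD (z w : sum_prod X Y) :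
  sum_norm (z + w) <= sum_norm z + sum_norm w.
Proof. by rewrite /sum_norm addrACA lerD// ler_normD. Qed.

Lemma sum_normZ (l : R) (z : sum_prod X Y) :
  sum_norm (l *: z) = `|l| * sum_norm z.
Proof. by rewrite /sum_norm mulrDr -!normrZ. Qed.

Lemma sum_norm_eq0 (z : sum_prod X Y) : sum_norm z = 0 -> z = 0.
Proof.
case: z => x y /eqP; rewrite /sum_norm paddr_eq0 ?normr_ge0// !normr_eq0/=.
by move=> /andP[/eqP -> /eqP ->].
Qed.

HB.instance Definition _ := Lmodule_isNormed.Build R (sum_prod X Y)
  ler_sum_normD sum_normZ sum_norm_eq0.

Lemma sum_prod_normE (z : sum_prod X Y) : `|z| = `|z.1| + `|z.2|.
Proof. by []. Qed.

End SumProd.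

Section Subdifferentials.
Context {R : realType}.

(* Functionals are plain functions, so that sums, opposites and multiples of
   sets of functionals use the pointwise operations on [Z -> R^o]. *)
Definition dual (Z : normedModType R) : set (Z -> R^o) :=
  [set zs | linear zs /\ continuous zs].

(* If [f xbar] is infinite then [`|f xbar - f xbar| = +oo] (as
   [+oo - +oo = -oo]), so calmness forces [f] to be finite on the ball. *)
Definition calm (X : normedModType R) (f : X -> \bar R) (xbar : X) : Prop :=
  exists r : R, exists l : R, [/\ 0 < r, 0 <= l &
    forall x, ball xbar r x ->
      (`|f x - f xbar| <= (l * `|x - xbar|)%:E)%E].

Definition reg_subdiff (X : normedModType R) (f : X -> \bar R) (xbar : X) :
    set (X -> R^o) :=
  [set xs | [/\ dual xs, f xbar \is a fin_num &
    forall e : R, 0 < e -> exists2 g : R, 0 < g &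
      forall x, ball xbar g x ->
        ((- (e * `|x - xbar|))%:E <=
           f x - f xbar - (xs (x - xbar))%:E)%E]].

Definition upper_reg_subdiff (X : normedModType R) (f : X -> \bar R)
    (xbar : X) : set (X -> R^o) :=
  [set - xs | xs in reg_subdiff (fun x => - f x)%E xbar].

(* The limsup is taken over [z -> zbar] with [z \in S] and [z != zbar]; it is
   [-oo] when [zbar] is isolated in [S]. *)
Definition reg_normal_cone (Z : normedModType R) (zbar : Z) (S : set Z) :
    set (Z -> R^o) :=
  [set zs | dual zs /\
    (limf_esup (fun z => (zs (`|z - zbar|^-1 *: (z - zbar)))%:E)
       (within S zbar^') <= 0)%E].

Definition epi (X : normedModType R) (f : X -> \bar R) :
    set (sum_prod X R^o) :=
  [set z | (f z.1 <= z.2%:E)%E].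

Definition dual_pair (X : normedModType R) (xs : X -> R^o) (b : R) :
    sum_prod X R^o -> R^o :=
  fun z => xs z.1 + b * z.2.

Definition sing_reg_subdiff (X : normedModType R) (f : X -> \bar R)
    (xbar : X) : set (X -> R^o) :=
  [set xs | [/\ dual xs, f xbar \is a fin_num &
    reg_normal_cone ((xbar, fine (f xbar)) : sum_prod X R^o) (epi f)
      (dual_pair xs 0)]].

(* For [f] finite near [xbar], [fine \o f] is [f] seen as a real-valued
   function near [xbar]. *)
Definition frechet_differentiable (X : normedModType R) (f : X -> \bar R)
    (xbar : X) : Prop :=
  (\forall x \near xbar, f x \is a fin_num) /\
  differentiable (fine \o f : X -> R^o) xbar.

Definition grad (X : normedModType R) (f : X -> \bar R) (xbar : X) :
    X -> R^o :=
  'd (fine \o f : X -> R^o) xbar.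

End Subdifferentials.

(* Main.v *)
Require Import Defs.
From mathcomp Require Import all_boot all_order all_algebra.
From mathcomp Require Import all_classical all_reals all_analysis.
From mathcomp Require Import ring lra.
Import Order.TTheory GRing.Theory Num.Theory.
Import numFieldNormedType.Exports.
Local Open Scope classical_set_scope.
Local Open Scope ring_scope.

(** Near [xbar], calmness makes [F1 x - F1 xbar] and [F2 x - F2 xbar] of order
    [`|x - xbar|], so in the first order expansions of [F1 * F2] and [F1 / F2]
    every quadratic term is [o(`|x - xbar|)]. The regular subdifferential only
    sees a function up to such terms, commutes with positive scaling, and is
    translated by the addition of a continuous linear functional. *)

Section FirstOrder.
Context {R : realType} {X : normedModType R} (xbar : X).
Implicit Types (f g : X -> \bar R) (F G h k : X -> R) (xs d : X -> R^o).

(** * Calculus of [O] and [o] estimates at [xbar] *)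

(** This is [h = O(x - xbar)], and [negligible_at] is [h = o(x - xbar)]. Here [h] stands for an
    increment [F x - F xbar] or a remainder, hence vanishes at [xbar]. *)
Definition lipschitz_at h : Prop :=
  exists2 l : R, 0 <= l & \forall x \near xbar, `|h x| <= l * `|x - xbar|.

Definition negligible_at h : Prop :=
  forall e : R, 0 < e -> \forall x \near xbar, `|h x| <= e * `|x - xbar|.

(** Subdifferentials depend only on values near [xbar], so an extended-real [f] can be traded for a
    real [F], on which field arithmetic is available. *)
Definition real_near f F : Prop := \forall x \near xbar, f x = (F x)%:E.

Lemma lipschitz_atM h k (l : R) : lipschitz_at h ->
  (\forall x \near xbar, `|k x| <= l) -> lipschitz_at (fun x => k x * h x).
Proof.
move=> [m m0 hm] kl; have l0 : 0 <= l.
  by have := nbhs_singleton kl; apply: le_trans.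
exists (l * m); first exact: mulr_ge0.
near=> x; rewrite normrM -mulrA ler_pM//; [near: x; exact: kl|].
by near: x; exact: hm.
Unshelve. all: by end_near. Qed.

Lemma lipschitz_atZ (c : R) h :
  lipschitz_at h -> lipschitz_at (fun x => c * h x).
Proof. by move=> hh; apply: (lipschitz_atM _ _ `|c|) => //; near=> x.
Unshelve. all: by end_near. Qed.

Lemma lipschitz_atD h k : lipschitz_at h -> lipschitz_at k ->
  lipschitz_at (fun x => h x + k x).
Proof.
move=> [l l0 hl] [m m0 km]; exists (l + m); first exact: addr_ge0.
near=> x; rewrite mulrDl (le_trans (ler_normD _ _))// lerD//.
- by near: x; exact: hl.
- by near: x; exact: km.
Unshelve. all: by end_near. Qed.

Lemma negligible_atD h k : negligible_at h -> negligible_at k ->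
  negligible_at (fun x => h x + k x).
Proof.
move=> ho ko e e0; have e2 : 0 < e / 2 by rewrite divr_gt0.
near=> x; rewrite (splitr e) mulrDl (le_trans (ler_normD _ _))// lerD//.
- by near: x; exact: ho.
- by near: x; exact: ko.
Unshelve. all: by end_near. Qed.

Lemma negligible_atZ (c : R) h :
  negligible_at h -> negligible_at (fun x => c * h x).
Proof.
move=> ho e e0; have c1 : 0 < `|c| + 1 by rewrite ltr_wpDl.
near=> x; rewrite normrM.
have : `|h x| <= e / (`|c| + 1) * `|x - xbar|.
  by near: x; apply: ho; rewrite divr_gt0.
rewrite mulrAC ler_pdivlMr// mulrC; apply: le_trans.
by rewrite ler_wpM2r// lerDl.
Unshelve. all: by end_near. Qed.

Lemma negligible_lipschitz_at h : negligible_at h -> lipschitz_at h.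
Proof. by move=> ho; exists 1 => //; exact: ho. Qed.

Lemma near_dist_le (e : R) : 0 < e -> \forall x \near xbar, `|x - xbar| <= e.
Proof.
move=> e0; apply/nbhs_ballP; exists e => //= x.
by rewrite -ball_normE /= distrC => /ltW.
Qed.

(** The product is bounded by a multiple of the square of [|x - xbar|], and one of the two factors
    can be made arbitrarily small. *)
Lemma negligible_at_mul h k : lipschitz_at h -> lipschitz_at k ->
  negligible_at (fun x => h x * k x).
Proof.
move=> [l l0 hl] [m m0 km] e e0.
have lm : 0 < l * m + 1 by rewrite ltr_wpDl// mulr_ge0.
near=> x; rewrite normrM.
have lxm : `|h x| * `|k x| <= l * m * `|x - xbar| * `|x - xbar|.
  rewrite -mulrA mulrACA ler_pM//; first by near: x; exact: hl.
  by near: x; exact: km.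
have : `|x - xbar| <= e / (l * m + 1).
  by near: x; apply: near_dist_le; rewrite divr_gt0.
rewrite ler_pdivlMr// => xe; apply: (le_trans lxm).
rewrite ler_wpM2r//; apply: le_trans xe.
by rewrite mulrC ler_wpM2l// lerDl.
Unshelve. all: by end_near. Qed.

(** Once the increment of [F] is at most half of [|F xbar|], the reverse triangle inequality keeps
    [|F x|] above the other half. *)
Lemma inv_near_bounded F : lipschitz_at (fun x => F x - F xbar) ->
  F xbar != 0 ->
  \forall x \near xbar, F x != 0 /\ `|(F x)^-1| <= 2 / `|F xbar|.
Proof.
move=> [l l0 hl] F0; have nF : 0 < `|F xbar| by rewrite normr_gt0.
have l1 : 0 < l + 1 by rewrite ltr_wpDl.
near=> x.
have FxF : `|F x - F xbar| <= `|F xbar| / 2.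
  have : `|x - xbar| <= `|F xbar| / 2 / (l + 1).
    by near: x; apply: near_dist_le; rewrite !divr_gt0.
  rewrite ler_pdivlMr// => xF; apply: le_trans xF.
  apply: (@le_trans _ _ (l * `|x - xbar|)); first by near: x; exact: hl.
  by rewrite mulrC ler_wpM2l// lerDl.
have Fx : `|F xbar| / 2 <= `|F x|.
  have := lerB_normD (F xbar) (F x - F xbar); rewrite subrKC => h.
  by rewrite (le_trans _ h)// lerBrDr; lra.
have Fx0 : 0 < `|F x| by apply: lt_le_trans Fx; rewrite divr_gt0.
split; first by rewrite -normr_gt0.
by rewrite normfV -invf_div lef_pV2// posrE// divr_gt0.
Unshelve. all: by end_near. Qed.

(** * Regular and singular subdifferentials through real representatives *)

Lemma reg_subdiff_real_near f F xs : real_near f F ->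
  reg_subdiff f xbar xs <-> dual xs /\
    forall e : R, 0 < e -> \forall x \near xbar,
      - (e * `|x - xbar|) <= F x - F xbar - xs (x - xbar).
Proof.
move=> fF; have fFx := nbhs_singleton fF; split.
  move=> [xsd _ H]; split => // e e0; have [r r0 Hr] := H e e0.
  have xr : \forall x \near xbar, ball xbar r x by exact: nbhsx_ballx.
  near=> x; have /Hr : ball xbar r x by near: x.
  rewrite fFx; have -> : f x = (F x)%:E by near: x.
  by rewrite -!EFinB lee_fin.
move=> [xsd H]; split => //; first by rewrite fFx.
move=> e e0.
have /nbhs_ballP[r r0 Hr] : \forall x \near xbar, f x = (F x)%:E /\
    - (e * `|x - xbar|) <= F x - F xbar - xs (x - xbar).
  by apply: filterI => //; exact: H.
exists r => // x /Hr[-> h].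
by rewrite fFx -!EFinB lee_fin.
Unshelve. all: by end_near. Qed.

Lemma dualZD (c : R) xs d : dual xs -> dual d -> dual (c *: xs + d).
Proof.
move=> [xsl xsc] [dl dc]; split.
  move=> a u v; rewrite !fctE xsl dl.
  by rewrite !scalerDr !scalerA [a * c]mulrC addrACA.
by move=> x; apply: cvgD; [apply: cvgZr; exact: xsc|exact: dc].
Qed.

Lemma dual0 {Z : normedModType R} : dual (0 : Z -> R^o).
Proof.
split; first by move=> a u v; rewrite [RHS]addr0 [RHS]mulr0.
by move=> x; exact: cvg_cst.
Qed.

(* [c <> 0] would not suffice: a negative factor exchanges lower and upper
   subdifferentials. *)
Lemma reg_subdiff_first_order f g F G (c : R) d : 0 < c -> dual d ->
  real_near f F -> real_near g G ->
  negligible_at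
    (fun x => F x - F xbar - (c * (G x - G xbar) + d (x - xbar))) ->
  reg_subdiff f xbar = [set c *: xs + d | xs in reg_subdiff g xbar].
Proof.
move=> c0 dd fF gG o; have cn0 : c != 0 by rewrite gt_eqF.
rewrite eqEsubset; split => [xs|_ [xs + <-]].
  move=> /(reg_subdiff_real_near _ _ _ fF)[xsd H].
  exists (c^-1 *: (xs - d)); last first.
    by rewrite scalerA divff// scale1r subrK.
  apply/(reg_subdiff_real_near _ _ _ gG); split.
    rewrite scalerBr -scaleNr addrC.
    have -> : c^-1 *: xs = c^-1 *: xs + 0 by rewrite addr0.
    by apply: dualZD => //; apply: dualZD => //; exact: dual0.
  (* Half of [c * e] absorbs the subgradient error of [f], the other half the first-order remainder;
     dividing by [c] leaves [e]. *)
  move=> e e0; have ce : 0 < c * e / 2 by rewrite divr_gt0// mulr_gt0.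
  near=> x.
  have Hx : - (c * e / 2 * `|x - xbar|) <= F x - F xbar - xs (x - xbar).
    by near: x; exact: H.
  have : `|F x - F xbar - (c * (G x - G xbar) + d (x - xbar))| <=
      c * e / 2 * `|x - xbar|.
    by near: x; exact: o.
  rewrite ler_norml !fctE => /andP[lo hi].
  rewrite -(ler_pM2l c0) !mulrBr mulVKf//.
  lra.
move=> /(reg_subdiff_real_near _ _ _ gG)[xsd H].
apply/(reg_subdiff_real_near _ _ _ fF); split; first exact: dualZD.
move=> e e0; have e2 : 0 < e / 2 by rewrite divr_gt0.
near=> x.
have Hx : - (e / 2 / c * `|x - xbar|) <= G x - G xbar - xs (x - xbar).
  by near: x; apply: H; rewrite divr_gt0.
have : `|F x - F xbar - (c * (G x - G xbar) + d (x - xbar))| <=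
    e / 2 * `|x - xbar|.
  by near: x; exact: o.
rewrite ler_norml => /andP[lo hi].
have {Hx} := ler_wpM2l (ltW c0) Hx.
rewrite mulrN mulrA [c * (_ / c)]mulrC divfK// !mulrBr.
have -> : (c *: xs + d) (x - xbar) = c * xs (x - xbar) + d (x - xbar) by [].
by move=> Hx; lra.
Unshelve. all: by end_near. Qed.

(* Calmness puts the rays in the directions [(u, l * `|u|)] locally in the
   epigraph, so a horizontal regular normal [(xs, 0)] satisfies [xs u <= 0]
   for every [u]. *)
Lemma sing_reg_subdiff_lipschitz_at f F : real_near f F ->
  lipschitz_at (fun x => F x - F xbar) -> sing_reg_subdiff f xbar = [set 0].
Proof.
move=> fF [l l0 hl]; have fFx := nbhs_singleton fF.
rewrite eqEsubset; split => [xs [[xsl xsc] _ []]|_ ->]; last first.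
  split; [exact: dual0|by rewrite fFx|split].
    have -> : dual_pair (0 : X -> R^o) 0 = 0.
      by apply/funext => z; rewrite /dual_pair mul0r addr0.
    exact: dual0.
  (* The limit superior is an infimum of suprema over members of the filter; for the zero functional
     the whole space already gives a supremum of zeros. *)
  apply: ereal_inf_le; exists (ereal_sup
    [set (@dual_pair R X 0 0
       (`|z - (xbar, fine (f xbar)) : sum_prod X R^o|^-1 *:
          (z - (xbar, fine (f xbar)) : sum_prod X R^o)))%:E
     | z in [set: sum_prod X R^o]]) => //.
    by exists setT => //; exact: filterT.
  apply: ge_ereal_sup => _ [z _ <-].
  by rewrite /dual_pair mul0r addr0.
move=> _ lim0.
have xs_le0 u : xs u <= 0.
  rewrite leNgt; apply/negP => xsu.
  have xs0 : xs 0 = 0.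
    by have := xsl (-1) 0 0; rewrite scaler0 addr0 scaleN1r addNr.
  have u0 : u != 0 by apply/eqP => u0; rewrite u0 xs0 ltxx in xsu.
  pose w : sum_prod X R^o := (u, l * `|u|).
  have uw : `|u| <= `|w| by rewrite sum_prod_normE /= lerDl.
  have w0 : 0 < `|w| by rewrite (lt_le_trans _ uw)// normr_gt0.
  (* By homogeneity [xs u / |w|] is the value of the normalized functional all along the ray through
     [w]. Were it positive, some [V] in the filter would have a strictly smaller supremum, which a
     point of the ray inside [V] refutes. *)
  have q0 : (0 < (xs u / `|w|)%:E)%E by rewrite lte_fin divr_gt0.
  move: (le_lt_trans lim0 q0) => /ereal_inf_lt[_ [V VF <-]].
  rewrite ltNge => /negP; apply.
  have /nbhs_ballP[r r0 Vr] : nbhs ((xbar, fine (f xbar)) : sum_prod X R^o)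
    (fun z => z != (xbar, fine (f xbar)) -> epi f z -> V z).
    exact: VF.
  have /nbhs_ballP[s s0 Hs] : \forall x \near xbar, f x = (F x)%:E /\
      `|F x - F xbar| <= l * `|x - xbar|.
    exact: filterI.
  (* The radius [r] keeps [z] where membership in [V] is known, and [s] keeps [xbar + t *: u] where
     the calmness bound holds; halving makes the bound strict. *)
  pose t := Num.min r s / 2 / `|w|.
  have t0 : 0 < t by rewrite !divr_gt0// lt_min r0.
  have tw : t * `|w| < Num.min r s.
    by rewrite /t divfK ?gt_eqF// ltr_pdivrMr// ltr_pMr ?ltr1n// lt_min r0.
  have /Hs[ftu Ftu] : ball xbar s (xbar + t *: u).
    rewrite -ball_normE /= opprD addNKr normrN normrZ gtr0_norm//.
    apply: (@le_lt_trans _ _ (t * `|w|)); first by rewrite ler_pM2l.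
    by rewrite (lt_le_trans tw)// ge_min lexx orbT.
  pose z := ((xbar, fine (f xbar)) : sum_prod X R^o) + t *: w.
  have zB : z - ((xbar, fine (f xbar)) : sum_prod X R^o) = t *: w.
    by rewrite addrC addKr.
  apply: ereal_sup_ge; exists (xs u / `|w|)%:E => //.
  exists z.
    apply: Vr.
    - rewrite -ball_normE /= opprD addNKr normrN normrZ gtr0_norm//.
      by rewrite (lt_le_trans tw)// ge_min lexx.
    - by rewrite -subr_eq0 zB scaler_eq0 gt_eqF//= -normr_gt0.
    - rewrite /epi /= ftu fFx lee_fin /=.
      move: Ftu; rewrite [xbar + _]addrC addrK normrZ gtr0_norm// mulrCA.
      by rewrite -lerBlDl; apply: le_trans; exact: ler_norm.
  rewrite zB normrZ gtr0_norm// scalerA invfM mulrAC mulVf ?gt_eqF// mul1r.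
  rewrite /dual_pair mul0r addr0 /=; congr EFin.
  have := xsl (`|w|^-1) u 0; rewrite xs0 !addr0 => ->.
  by rewrite mulrC.
(* The reverse inequality is [xs_le0] at [- u], by linearity. *)
apply/funext => u; apply/eqP; rewrite eq_le xs_le0/=.
rewrite -oppr_le0; have := xsl (-1) u 0; have := xsl (-1) 0 0.
rewrite scaler0 addr0 scaleN1r addNr addr0 => ->.
by rewrite addr0 !scaleN1r => <-.
Qed.

Lemma reg_subdiff_first_orderZ f g F G (c : R) : 0 < c ->
  real_near f F -> real_near g G ->
  negligible_at (fun x => F x - F xbar - c * (G x - G xbar)) ->
  reg_subdiff f xbar = [set c *: xs | xs in reg_subdiff g xbar].
Proof.
move=> c0 fF gG ho.
rewrite (reg_subdiff_first_order f g F G c 0 c0 dual0 fF gG).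
  by apply: eq_imagel => xs _; rewrite addr0.
rewrite (_ : (fun x => _) =
  (fun x => F x - F xbar - c * (G x - G xbar)))//.
by apply/funext => x; congr (_ - _); rewrite -[RHS]addr0.
Qed.

(** * Calm and Fréchet differentiable functions *)

(** A finite bound on the increment excludes infinite values, first at the center and then on the
    whole ball, so [fine] loses nothing there. *)
Lemma calm_real_near f : calm f xbar -> real_near f (fine \o f) /\
  lipschitz_at (fun x => fine (f x) - fine (f xbar)).
Proof.
move=> [r [l [r0 l0 H]]].
have fx : f xbar \is a fin_num.
  have := H _ (ballxx _ r0); rewrite subrr normr0 mulr0.
  by case: (f xbar).
have ffin x : ball xbar r x -> f x \is a fin_num.
  by move=> /H; move: fx; case: (f xbar) => // a _; case: (f x).
have xr : \forall x \near xbar, ball xbar r x by exact: nbhsx_ballx.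
split; first by apply: filterS xr => x /ffin /= /fineK.
exists l => //; apply: filterS xr => x xrx.
by have := H x xrx; rewrite -(fineK fx) -(fineK (ffin x xrx)) -EFinB lee_fin.
Qed.

Lemma dual_grad f : frechet_differentiable f xbar -> dual (grad f xbar).
Proof.
move=> [_ df]; split; first by move=> a u v; rewrite /grad linearP.
by move=> x; exact: diff_continuous.
Qed.

Lemma negligible_at_grad f : frechet_differentiable f xbar ->
  negligible_at (fun x => fine (f x) - fine (f xbar) - grad f xbar (x - xbar)).
Proof.
move=> [_ df] e e0; have /eqaddoP/(_ e e0) := diff_locally df.
move=> /nbhs_ballP[r r0 H]; apply/nbhs_ballP; exists r => // x xr.
(* The differential's remainder is controlled near [0] in the increment; translation by [xbar]
   brings it to the form used here. *)
have /H : ball (0 : X) r (x - xbar).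
  by move: xr; rewrite -!ball_normE /= sub0r normrN distrC.
by rewrite /grad !fctE /shift /= subrK opprD addrA.
Qed.

(** Allows rewriting by identities valid only near [xbar], such as those requiring a nonzero
    denominator. *)
Lemma negligible_at_near_eq h k : (\forall x \near xbar, h x = k x) ->
  negligible_at h -> negligible_at k.
Proof.
move=> hk ho e e0; near=> x; have <- : h x = k x by near: x.
by near: x; exact: ho.
Unshelve. all: by end_near. Qed.

(** * First-order expansions of products and quotients *)

Section Arithmetic.
Variables F G : X -> R.
Hypothesis Flip : lipschitz_at (fun x => F x - F xbar).
Hypothesis Glip : lipschitz_at (fun x => G x - G xbar).

(** The remainder is exactly [(F x - F xbar) * (G x - G xbar)]. *)
Lemma mul_first_order : negligible_at (fun x => F x * G x - F xbar * G xbar -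
  (G xbar * (F x - F xbar) + F xbar * (G x - G xbar))).
Proof.
apply: negligible_at_near_eq (negligible_at_mul _ _ Flip Glip).
by near=> x; ring.
Unshelve. all: by end_near. Qed.

Lemma lipschitz_at_mul :
  lipschitz_at (fun x => F x * G x - F xbar * G xbar).
Proof.
have := lipschitz_atD _ _ (negligible_lipschitz_at _ mul_first_order)
  (lipschitz_atD _ _ (lipschitz_atZ (G xbar) _ Flip)
     (lipschitz_atZ (F xbar) _ Glip)).
by congr (lipschitz_at _); apply/funext => x; ring.
Qed.

(** With [N = G xbar * (F x - F xbar) - F xbar * (G x - G xbar)], the increment of the quotient is
    [N / (G x * G xbar)]. The remainder is thus [- N * (G x - G xbar) / (G x * G xbar ^+ 2)], a
    product of two [O] terms because [1 / G] is bounded near [xbar]. *)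
Lemma div_first_order : G xbar != 0 ->
  negligible_at (fun x => F x / G x - F xbar / G xbar -
    (G xbar ^+ 2)^-1 * (G xbar * (F x - F xbar) - F xbar * (G x - G xbar))).
Proof.
move=> G0; have Ginv := inv_near_bounded _ Glip G0.
have Gxb : \forall x \near xbar, `|(G x)^-1| <= 2 / `|G xbar|.
  by apply: filterS Ginv => x [].
have num := lipschitz_atD _ _ (lipschitz_atZ (G xbar) _ Flip)
  (lipschitz_atZ (- F xbar) _ Glip).
have := negligible_atZ (- (G xbar ^+ 2)^-1) _
  (negligible_at_mul _ _ num (lipschitz_atM _ _ _ Glip Gxb)).
apply: negligible_at_near_eq; apply: filterS Ginv => x [Gx _].
by field; rewrite Gx G0.
Qed.

Lemma lipschitz_at_div : G xbar != 0 ->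
  lipschitz_at (fun x => F x / G x - F xbar / G xbar).
Proof.
move=> G0.
have := lipschitz_atD _ _ (negligible_lipschitz_at _ (div_first_order G0))
  (lipschitz_atZ (G xbar ^+ 2)^-1 _
    (lipschitz_atD _ _ (lipschitz_atZ (G xbar) _ Flip)
       (lipschitz_atZ (- F xbar) _ Glip))).
by congr (lipschitz_at _); apply/funext => x; ring.
Qed.

End Arithmetic.

(** * Real representatives of extended-real operations *)

Lemma real_nearM f g F G : real_near f F -> real_near g G ->
  real_near (fun x => f x * g x)%E (fun x => F x * G x).
Proof. by apply: filterS2 => x -> ->. Qed.

Lemma real_nearD f g F G : real_near f F -> real_near g G ->
  real_near (fun x => f x + g x)%E (fun x => F x + G x).
Proof. by apply: filterS2 => x -> ->. Qed.

Lemma real_nearN f F : real_near f F ->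
  real_near (fun x => - f x)%E (fun x => - F x).
Proof. by apply: filterS => x ->. Qed.

Lemma real_nearZ (a : \bar R) f F : a \is a fin_num -> real_near f F ->
  real_near (fun x => a * f x)%E (fun x => fine a * F x).
Proof. by move=> /fineK a_fin; apply: filterS => x ->; rewrite -{1}a_fin. Qed.

(** The extended and real inverses agree away from [0], and [F] stays nonzero near [xbar]. *)
Lemma real_nearV f F : real_near f F ->
  lipschitz_at (fun x => F x - F xbar) -> F xbar != 0 ->
  real_near (fun x => (f x)^-1)%E (fun x => (F x)^-1).
Proof.
move=> fF Flip F0.
apply: filterS2 fF (inv_near_bounded _ Flip F0) => x -> [/negPf Fx _].
by rewrite inver Fx.
Qed.

(** The increment of a constant is left as [a - a] to match the shape [F x - F xbar], so that a
    reciprocal can be treated as a quotient with constant numerator. *)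
Lemma lipschitz_at_cst (a : R) : lipschitz_at (fun=> a - a).
Proof. by exists 0 => //; near=> x; rewrite subrr normr0 mul0r.
Unshelve. all: by end_near. Qed.

End FirstOrder.

(** * Product, quotient and reciprocal rules *)

Theorem corollary5p2 (R : realType) (X : normedModType R) (xbar : X)
    (phi1 phi2 : X -> \bar R)
    (phi1_gtNy : forall x, (-oo < phi1 x)%E)
    (phi2_gtNy : forall x, (-oo < phi2 x)%E)
    (calm1 : calm phi1 xbar) (calm2 : calm phi2 xbar) :
  (* (i) *)
  [/\ reg_subdiff (fun x => phi1 x * phi2 x)%E xbar =
        reg_subdiff (fun x => phi2 xbar * phi1 x + phi1 xbar * phi2 x)%E xbar,
      sing_reg_subdiff (fun x => phi1 x * phi2 x)%E xbar = [set 0] &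
      frechet_differentiable phi1 xbar ->
        reg_subdiff (fun x => phi1 x * phi2 x)%E xbar =
          [set fine (phi2 xbar) *: grad phi1 xbar + xs
             | xs in reg_subdiff (fun x => phi1 xbar * phi2 x)%E xbar]]
  (* (ii) *)
  /\ (phi2 xbar != 0%E ->
      [/\ reg_subdiff (fun x => phi1 x / phi2 x)%E xbar =
            [set (fine (phi2 xbar) ^+ 2)^-1 *: xs
               | xs in reg_subdiff
                   (fun x => phi2 xbar * phi1 x - phi1 xbar * phi2 x)%E xbar],
          sing_reg_subdiff (fun x => phi1 x / phi2 x)%E xbar = [set 0] &
          frechet_differentiable phi1 xbar ->
            reg_subdiff (fun x => phi1 x / phi2 x)%E xbar =
              [set (fine (phi2 xbar) ^+ 2)^-1 *:
                     (fine (phi2 xbar) *: grad phi1 xbar + xs)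
                 | xs in reg_subdiff
                     (fun x => - phi1 xbar * phi2 x)%E xbar]])
  (* (iii) *)
  /\ (forall phi : X -> \bar R, (forall x, (-oo < phi x)%E) ->
      calm phi xbar -> phi xbar != 0%E ->
        reg_subdiff (fun x => (phi x)^-1)%E xbar =
          [set - ((fine (phi xbar) ^+ 2)^-1 *: xs)
             | xs in upper_reg_subdiff phi xbar]
        /\ sing_reg_subdiff (fun x => (phi x)^-1)%E xbar = [set 0]).

Proof.
have [f1F lip1] := calm_real_near _ _ calm1.
have [f2F lip2] := calm_real_near _ _ calm2.
have fin1 : phi1 xbar \is a fin_num by rewrite (nbhs_singleton f1F).
have fin2 : phi2 xbar \is a fin_num by rewrite (nbhs_singleton f2F).
split; last split.
- have prodF := real_nearM _ _ _ _ _ f1F f2F.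
  split.
  + rewrite (reg_subdiff_first_orderZ _ _ _ _ _ 1 ltr01 prodF
      (real_nearD _ _ _ _ _ (real_nearZ _ _ _ _ fin2 f1F)
         (real_nearZ _ _ _ _ fin1 f2F))).
      by rewrite -[RHS]image_id; apply: eq_imagel => xs _; rewrite scale1r.
    apply: negligible_at_near_eq (mul_first_order _ _ _ lip1 lip2).
    by near=> x; rewrite /=; ring.
  + apply: sing_reg_subdiff_lipschitz_at prodF _.
    exact: lipschitz_at_mul lip1 lip2.
  + move=> df1; have grad1 := dual_grad _ _ df1.
    have d1 : dual (fine (phi2 xbar) *: grad phi1 xbar).
      by rewrite -[_ *: _]addr0; apply: dualZD => //; exact: dual0.
    rewrite (reg_subdiff_first_order _ _ _ _ _ 1 _ ltr01 d1 prodF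
      (real_nearZ _ _ _ _ fin1 f2F)).
      by apply: eq_imagel => xs _; rewrite scale1r addrC.
    (* The error is the bilinear remainder of the product plus [phi2 xbar] times the remainder of
       the differential of [phi1]. *)
    apply: negligible_at_near_eq
      (negligible_atD _ _ _ (mul_first_order _ _ _ lip1 lip2)
         (negligible_atZ _ (fine (phi2 xbar)) _
            (negligible_at_grad _ _ df1))).
    near=> x; rewrite /=.
    have -> : (fine (phi2 xbar) *: grad phi1 xbar) (x - xbar) =
      fine (phi2 xbar) * grad phi1 xbar (x - xbar) by [].
    by ring.
- rewrite -{1}(fineK fin2) eqe => a20.
  have c0 : 0 < (fine (phi2 xbar) ^+ 2)^-1 by rewrite invr_gt0 exprn_even_gt0.
  have divF := real_nearM _ _ _ _ _ f1F (real_nearV _ _ _ f2F lip2 a20).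
  split.
  + apply: (reg_subdiff_first_orderZ _ _ _ _ _ _ c0 divF
      (real_nearD _ _ _ _ _ (real_nearZ _ _ _ _ fin2 f1F)
         (real_nearN _ _ _ (real_nearZ _ _ _ _ fin1 f2F)))).
    apply: negligible_at_near_eq (div_first_order _ _ _ lip1 lip2 a20).
    by near=> x; rewrite /=; ring.
  + apply: sing_reg_subdiff_lipschitz_at divF _.
    exact: lipschitz_at_div lip1 lip2 a20.
  + move=> df1; have grad1 := dual_grad _ _ df1.
    (* The scaling by [c] also reaches the gradient, so the translating functional has coefficient
       [c * phi2 xbar]. *)
    set c := _^-1 in c0 *; pose c2 := c * fine (phi2 xbar).
    have d1 : dual (c2 *: grad phi1 xbar).
      by rewrite -[_ *: _]addr0; apply: dualZD => //; exact: dual0.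
    have finN1 : (- phi1 xbar)%E \is a fin_num by rewrite fin_numN.
    rewrite (reg_subdiff_first_order _ _ _ _ _ _ _ c0 d1 divF
      (real_nearZ _ _ _ _ finN1 f2F)).
      by apply: eq_imagel => xs _; rewrite scalerDr scalerA addrC.
    apply: negligible_at_near_eq
      (negligible_atD _ _ _ (div_first_order _ _ _ lip1 lip2 a20)
         (negligible_atZ _ c2 _ (negligible_at_grad _ _ df1))).
    near=> x; rewrite /= fineN -/c.
    have -> : (c2 *: grad phi1 xbar) (x - xbar) =
      c2 * grad phi1 xbar (x - xbar) by [].
    by rewrite /c2; ring.
- move=> phi _ /calm_real_near[fF lip] phi0.
  have fin : phi xbar \is a fin_num by rewrite (nbhs_singleton fF).
  have a0 : fine (phi xbar) != 0 by rewrite -eqe fineK.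
  have c0 : 0 < (fine (phi xbar) ^+ 2)^-1 by rewrite invr_gt0 exprn_even_gt0.
  have invF := real_nearV _ _ _ fF lip a0.
  split.
  (* To first order the increment of [1 / phi] is [- c] times that of [phi], where [c] is the
     inverse square of [phi xbar]. The sign is moved into [- phi] to keep the factor positive, which
     is how the upper subdifferential enters. *)
  + rewrite (reg_subdiff_first_orderZ _ _ _ _ _ _ c0 invF
      (real_nearN _ _ _ fF)).
      rewrite /upper_reg_subdiff image_comp; apply: eq_imagel => xs _ /=.
      by rewrite scalerN opprK.
    apply: negligible_at_near_eq
      (div_first_order _ _ _ (lipschitz_at_cst _ 1) lip a0).
    by near=> x; rewrite /=; ring.
  + apply: sing_reg_subdiff_lipschitz_at invF _.
    have := lipschitz_at_div _ _ _ (lipschitz_at_cst _ 1) lip a0.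
    by congr (lipschitz_at _); apply/funext => x /=; rewrite !mul1r.
Unshelve. all: by end_near. Qed.
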